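(* For every $d\in\mathbb{N}$, $d\ge1$, the lattice $\mathbb{Z}^d$ admits a harmonic labeling, i.e. there is a bijection $\phi:\mathbb{Z}^d\to\mathbb{Z}$ such that for every $x\in\mathbb{Z}^d$, $\phi(x)=\frac{1}{2d}\sum_{j=1}^d\big(\phi(x+e_j)+\phi(x-e_j)\big)$, where $e_1,\dots,e_d$ are the standard unit vectors.
   Context: $\mathbb{Z}^d$ is the graph with vertex set $\mathbb{Z}^d$ where two points are adjacent iff they differ by $1$ in exactly one coordinate. A harmonic labeling of a graph is a bijection $\phi:V\to\mathbb{Z}$ with $\phi(x)=\frac{1}{\deg(x)}\sum_{y\sim x}\phi(y)$ for every vertex $x$. *)

(* Defs.v *)
From HB Require Import structures.
From mathcomp Require Import all_boot all_order all_algebra.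

Set Implicit Arguments.
Unset Strict Implicit.
Unset Printing Implicit Defensive.

Import Order.TTheory GRing.Theory Num.Theory.
Local Open Scope ring_scope.

(* [s] lists each neighbour of [x] exactly once, so [size s] is the degree of
   [x]; such a list exists only if [x] has finite degree. *)
Definition neighbours (V : eqType) (adj : rel V) (x : V) (s : seq V) : Prop :=
  uniq s /\ s =i adj x.

(* The mean is taken in [rat]. Since [0^-1 = 0] in MathComp, the condition
   [(0 < size s)%N] rules out isolated vertices, where the mean is undefined. *)
Definition harmonic_at (V : eqType) (adj : rel V) (phi : V -> int) (x : V)
    : Prop :=
  exists s : seq V,
    [/\ neighbours adj x s, (0 < size s)%N &
        (phi x)%:~R = (size s)%:R^-1 * \sum_(y <- s) (phi y)%:~R :> rat].

Definition harmonic_labeling (V : eqType) (adj : rel V) (phi : V -> int)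
    : Prop :=
  bijective phi /\ forall x : V, harmonic_at adj phi x.

Definition lattice_adj (d : nat) : rel 'rV[int]_d :=
  fun x y => [exists i : 'I_d,
    (`|x ord0 i - y ord0 i| == 1)
    && [forall j : 'I_d, (j != i) ==> (x ord0 j == y ord0 j)]].

Definition unit_vec (d : nat) (j : 'I_d) : 'rV[int]_d := delta_mx ord0 j.

(* Main.v *)
(* For [d = 1] take the identity.  For [d >= 2] a harmonic function on Z^2 is
   determined by its values on two adjacent rows, which are arbitrary integers.
   Let [cone] be the one equal to the unit mass at 0 on row 0 and to 0 on row -1.
   Its translate by [a] vanishes on the l1-ball of radius [|a| - 1], and its
   values on the first three antidiagonals meeting its support, which are
   explicit, suffice to separate far away points.  Composing with pairs of
   coordinates gives harmonic functions on Z^d vanishing on a large ball.  The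
   labeling is a limit of harmonic functions, each agreeing with the previous
   one on a ball and injective on a larger ball.  At each stage a missing value
   [m] is placed at a far point [v] on a coordinate axis; among the functions
   with these prescribed values, a generic one is injective on the next ball,
   because the translates by [a <> v] still separate points and vanish at [v]. *)
Require Import Defs.
From HB Require Import structures.
From mathcomp Require Import all_boot all_order all_algebra.
From Stdlib Require Import ClassicalEpsilon.
From mathcomp Require Import zify ring.

Set Implicit Arguments.
Unset Strict Implicit.
Unset Printing Implicit Defensive.

Import Order.TTheory GRing.Theory Num.Theory.
Local Open Scope ring_scope.

(** * Harmonic functions on the plane *)

Definition planar_harmonic (h : int -> int -> int) : Prop :=
  forall x t, h (x + 1) t + h (x - 1) t + h x (t + 1) + h x (t - 1) = 4 * h x t.

(** The recursion is harmonicity solved for the upper neighbour; the [0] in the last branch is row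
    -1. *)
Fixpoint cone_row (t : nat) (x : int) : int :=
  if t is t'.+1 then
    4 * cone_row t' x - cone_row t' (x + 1) - cone_row t' (x - 1)
    - (if t' is t''.+1 then cone_row t'' x else 0)
  else (x == 0)%:Z.

(* Rows [t < 0] are the odd reflection of the rows [t >= 0] about row -1. *)
Definition cone (x t : int) : int :=
  match t with
  | Posz k => cone_row k x
  | Negz 0 => 0
  | Negz k.+1 => - cone_row k x
  end.

Lemma cone_rowS2 t x :
  cone_row t.+2 x =
  4 * cone_row t.+1 x - cone_row t.+1 (x + 1) - cone_row t.+1 (x - 1)
  - cone_row t x.
Proof. by []. Qed.

Lemma cone_harmonic : planar_harmonic cone.
Proof.
move=> x [[|k]|[|[|k]]].
- by rewrite /cone /=; ring.
- have -> : Posz k.+1 + 1 = Posz k.+2 by lia.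
  have -> : Posz k.+1 - 1 = Posz k by lia.
  by rewrite /cone cone_rowS2; ring.
- by rewrite /cone /=; ring.
- by rewrite /cone /=; ring.
- have -> : Negz k.+2 + 1 = Negz k.+1 by lia.
  have -> : Negz k.+2 - 1 = Negz k.+3 by lia.
  by rewrite /cone cone_rowS2; ring.
Qed.

Lemma cone_row_eq0 t x : x + t%:Z < 0 -> cone_row t x = 0.
Proof.
elim/ltn_ind: t x => -[|[|t]] IH x hx.
- by rewrite /=; case: eqP => // ?; lia.
- by rewrite /=; do ![case: eqP => //= ?]; lia.
- by rewrite cone_rowS2 !IH //; lia.
Qed.

Lemma cone_row_edge0 t x : x + t%:Z = 0 -> cone_row t x = (-1) ^+ t.
Proof.
elim/ltn_ind: t x => -[|[|t]] IH x hx.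
- by have -> : x = 0 by lia.
- by have -> : x = -1 by lia.
- rewrite cone_rowS2 (cone_row_eq0 (t := t)) ?(IH _ _ (x + 1)) //; try lia.
  rewrite !(@cone_row_eq0 t.+1); try lia.
  by rewrite !exprS; ring.
Qed.

(** Up to the alternating sign these values form an arithmetic progression: each row adds [4] times
    the edge value above to minus the previous term. *)
Lemma cone_row_edge1 t x :
  x + t%:Z = 1 -> cone_row t x = - 4 * t%:Z * (-1) ^+ t.
Proof.
elim/ltn_ind: t x => -[|[|t]] IH x hx.
- by have -> : x = 1 by lia.
- by have -> : x = 0 by lia.
- rewrite cone_rowS2 (cone_row_eq0 (t := t)) ?(IH _ _ (x + 1)) //; try lia.
  rewrite (@cone_row_edge0 t.+1 x) ?(@cone_row_eq0 t.+1 (x - 1)); try lia.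
  by rewrite !exprS -!(addn1 t.+1) -(addn1 t) !PoszD; ring.
Qed.

(** Starts at row 1: on row 0 the site 2 carries 0, not the value 1 that the formula would give. *)
Lemma cone_row_edge2 t x :
  x + t%:Z = 1 -> cone_row t.+1 x = (-1) ^+ t.+1 * (8 * t%:Z * t.+1%:Z + 1).
Proof.
elim/ltn_ind: t x => -[|[|t]] IH x hx.
- by have -> : x = 1 by lia.
- by have -> : x = 0 by lia.
- rewrite cone_rowS2 (IH _ _ (x + 1)) //; try lia.
  rewrite (@cone_row_edge1 t.+2 x) ?(@cone_row_edge0 t.+2 (x - 1)); try lia.
  rewrite (@cone_row_edge0 t.+1 x); try lia.
  by rewrite !exprS -!(addn1 t.+2) -!(addn1 t.+1) -(addn1 t) !PoszD; ring.
Qed.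

Lemma cone_eq0_up x t : 0 <= t -> x + t < 0 -> cone x t = 0.
Proof. by case: t => // t _; apply: cone_row_eq0. Qed.

Lemma cone_eq0_down x t : t < 0 -> x - t < 2 -> cone x t = 0.
Proof.
case: t => // -[|t] _ hx //=.
by rewrite cone_row_eq0 ?oppr0 //; lia.
Qed.

Lemma cone_eq0 x t : x + `|t| < 0 -> cone x t = 0.
Proof.
move=> hx; have [t0|t0] := leP 0 t; first by apply: cone_eq0_up; lia.
by apply: cone_eq0_down; lia.
Qed.

Lemma cone_base x : cone x 0 = (x == 0)%:Z.
Proof. by []. Qed.

Lemma cone_edge0 x t : 0 <= t -> x + t = 0 -> cone x t = (-1) ^+ `|t|%N.
Proof. by case: t => // t _; apply: cone_row_edge0. Qed.

Lemma cone_edge1 x t :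
  0 <= t -> x + t = 1 -> cone x t = - 4 * t * (-1) ^+ `|t|%N.
Proof. by case: t => // t _; apply: cone_row_edge1. Qed.

Lemma cone_edge2 x t :
  0 < t -> x + t = 2 -> cone x t = (-1) ^+ `|t|%N * (8 * (t - 1) * t + 1).
Proof.
case: t => // -[|t] // _ hx.
have -> : t.+1%:Z - 1 = t by lia.
by apply: cone_row_edge2; lia.
Qed.

(** * Separating points of the plane by translated cones *)

Lemma signz_cases k : (-1) ^+ k = 1 :> int \/ (-1) ^+ k = -1 :> int.
Proof. by rewrite -signr_odd; case: odd; [right|left]. Qed.

(** Put N = x + t. The choice [a] = N works unless (y, s) lies on the same side of the l1-sphere of
    radius N; then [a] = N - 1 is taken. If the choice would equal [R], the next smaller value is
    used. *)
Lemma cone_separates (n R x t y s : int) :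
  0 <= x -> 0 <= t -> n < x + t -> `|y| + `|s| <= x + t ->
  ~ (x = y /\ t = s) -> ~ (x = R /\ t = 0) -> ~ (y = R /\ s = 0) ->
  (x + t = R -> n + 1 < x + t) ->
  (`|y| + `|s| = x + t -> n + 2 < x + t) ->
  exists a, [/\ n < a, a != R & cone (x - a) t != cone (y - a) s].
Proof.
move=> x0 t0 nN yN neq pv qv hR hN.
have [/and3P[/eqP lev y0 s0]|off] :=
    boolP [&& y + s == x + t, 0 <= y & 0 <= s].
  have [eR|neR] := eqVneq (x + t - 1) R.
    exists (x + t - 2); split; [lia|lia|].
    have [et|nt] := eqVneq t 0.
      rewrite et cone_base (@cone_edge2 _ s); try lia.
      have -> : (x - (x + 0 - 2) == 0) = false by lia.
      have h : 8 * (s - 1) * s + 1 >= 1 by nia.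
      by case: (signz_cases `|s|) => ->; lia.
    have [es|ns] := eqVneq s 0.
      rewrite es cone_base (@cone_edge2 _ t); try lia.
      have -> : (y - (x + t - 2) == 0) = false by lia.
      have h : 8 * (t - 1) * t + 1 >= 1 by nia.
      by case: (signz_cases `|t|) => ->; lia.
    rewrite !cone_edge2; try lia.
    have h1 : 8 * (s - 1) * s + 1 >= 1 by nia.
    have h2 : 8 * (t - 1) * t + 1 >= 1 by nia.
    have h : 8 * (s - 1) * s + 1 != 8 * (t - 1) * t + 1.
      apply/eqP => e.
      (* Both factors are nonzero: distinct points of one side have different rows, and here both
         rows are at least 1. *)
      have : (s - t) * (s + t - 1) = 0 by lia.
      by move/eqP; rewrite mulf_eq0; lia.
    by case: (signz_cases `|s|) => ->; case: (signz_cases `|t|) => ->; lia.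
  exists (x + t - 1); split; [lia|lia|].
  rewrite !cone_edge1; try lia.
  by case: (signz_cases `|s|) => ->; case: (signz_cases `|t|) => ->; lia.
have [eR|neR] := eqVneq (x + t) R.
  (* The value at (x, t) is a nonzero multiple of 4, as (x, t) is not (R, 0); the value at (y, s) is
     0, 1 or -1. *)
  exists (x + t - 1); split; [lia|lia|].
  rewrite cone_edge1; try lia.
  have [s0|s0] := leP 0 s; last first.
    rewrite (@cone_eq0_down _ s); try lia.
    by case: (signz_cases `|t|) => ->; lia.
  have [lv|lv] := eqVneq (y + s) (x + t - 1).
    rewrite cone_edge0; try lia.
    by case: (signz_cases `|s|) => ->; case: (signz_cases `|t|) => ->; lia.
  rewrite (@cone_eq0_up _ s); try lia.
  by case: (signz_cases `|t|) => ->; lia.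
exists (x + t); split; [lia|lia|].
rewrite cone_edge0; try lia.
have -> : cone (y - (x + t)) s = 0.
  have [s0|s0] := leP 0 s; first by apply: cone_eq0_up; lia.
  by apply: cone_eq0_down; lia.
by case: (signz_cases `|t|) => ->.
Qed.

Lemma planar_harmonic_reflect (h : int -> int -> int) (sx st : bool) (a : int) :
  planar_harmonic h ->
  planar_harmonic (fun x t => h ((if sx then - x else x) - a)
                                (if st then - t else t)).
Proof.
move=> hh x t; case: sx; case: st.
- have := hh (- x - a) (- t).
  have -> : - x - a + 1 = - (x - 1) - a by ring.
  have -> : - x - a - 1 = - (x + 1) - a by ring.
  have -> : - t + 1 = - (t - 1) by ring.
  have -> : - t - 1 = - (t + 1) by ring.
  by move=> <-; ring.
- have := hh (- x - a) t.
  have -> : - x - a + 1 = - (x - 1) - a by ring.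
  have -> : - x - a - 1 = - (x + 1) - a by ring.
  by move=> <-; ring.
- have := hh (x - a) (- t).
  have -> : x - a + 1 = x + 1 - a by ring.
  have -> : x - a - 1 = x - 1 - a by ring.
  have -> : - t + 1 = - (t - 1) by ring.
  have -> : - t - 1 = - (t + 1) by ring.
  by move=> <-; ring.
- have := hh (x - a) t.
  have -> : x - a + 1 = x + 1 - a by ring.
  have -> : x - a - 1 = x - 1 - a by ring.
  by move=> <-; ring.
Qed.

(** Reflections by the signs of [x] and [t] reduce to the quadrant of [cone_separates]. Row 0 of a
    cone is a point mass, so avoiding the reflected [R] as translate makes [h R 0] vanish. *)
Lemma planar_separation_le (n R x t y s : int) :
  0 <= n -> n < `|x| + `|t| -> `|y| + `|s| <= `|x| + `|t| ->
  ~ (x = y /\ t = s) -> ~ (x = R /\ t = 0) -> ~ (y = R /\ s = 0) ->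
  (`|x| + `|t| = `|R| -> n + 1 < `|x| + `|t|) ->
  (`|y| + `|s| = `|x| + `|t| -> n + 2 < `|x| + `|t|) ->
  exists h, [/\ planar_harmonic h,
    forall u w, `|u| + `|w| <= n -> h u w = 0, h R 0 = 0 & h x t != h y s].
Proof.
move=> n0 nN yN neq pv qv hR hN.
pose fl (b : bool) (z : int) := if b then - z else z.
have absfl b z : `|fl b z| = `|z| 
  by case: b; rewrite /fl ?normrN.
have flE b z w : fl b z = w -> z = fl b w.
  by move=> <-; rewrite /fl; case: b => //; rewrite opprK.
have fl_ge0 z : 0 <= fl (z < 0) z by rewrite /fl; case: ltP; lia.
have fl0 b : fl b 0 = 0 by rewrite /fl oppr0 if_same.
have inj b z w : fl b z = fl b w -> z = w.
  by move=> /flE ->; rewrite /fl; case: b => //; rewrite opprK.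
have [a [an aR sep]] : exists a, [/\ n < a, a != fl (x < 0) R &
    cone (fl (x < 0) x - a) (fl (t < 0) t) !=
    cone (fl (x < 0) y - a) (fl (t < 0) s)].
  have ex := ger0_norm (fl_ge0 x); rewrite absfl in ex.
  have et := ger0_norm (fl_ge0 t); rewrite absfl in et.
  apply: cone_separates; rewrite ?absfl -?ex -?et //.
  - move=> [exy ets]; apply: neq.
    by rewrite ex et in exy ets; rewrite (inj _ _ _ exy) (inj _ _ _ ets).
  - rewrite ex et => -[exR et0]; apply: pv; split; first exact: inj exR.
    by apply: (inj (t < 0)); rewrite fl0.
  - move=> [eyR es0]; apply: qv; split; first exact: inj eyR.
    by apply: (inj (t < 0)); rewrite fl0.
  - by move=> e; apply: hR; rewrite e -(absfl (x < 0) R) -e; lia.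
exists (fun u w => cone (fl (x < 0) u - a) (fl (t < 0) w)); split => //.
- exact: planar_harmonic_reflect cone_harmonic.
- move=> u w uw; apply: cone_eq0; rewrite absfl.
  have := ler_norm (fl (x < 0) u); rewrite absfl.
  by move: uw an; clear; lia.
- rewrite fl0 cone_base.
  by have -> : (fl (x < 0) R - a == 0) = false by move: aR; clear; lia.
Qed.

(** If (y, s) is (R, 0), where [h] has to vanish, the origin takes its place; otherwise the point of
    larger norm goes first. *)
Lemma planar_separation_nz (n R x t y s : int) :
  0 <= n -> R != 0 -> n + 2 < `|x| + `|t| ->
  ~ (x = y /\ t = s) -> ~ (x = R /\ t = 0) ->
  exists h, [/\ planar_harmonic h,
    forall u w, `|u| + `|w| <= n -> h u w = 0, h R 0 = 0 & h x t != h y s].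
Proof.
move=> n0 R0 big neq pv.
have [/andP[/eqP yR /eqP s0]|qv] := boolP ((y == R) && (s == 0)).
  have [||||||||h [hh hB hR]] := @planar_separation_le n R x t 0 0; try lia.
  by rewrite (hB 0 0) // => hx; exists h; split; rewrite ?yR ?s0 ?hR.
have [le|lt] := leP (`|y| + `|s|) (`|x| + `|t|).
  by apply: planar_separation_le; lia.
have [||||||||h [hh hB hR hx]] := @planar_separation_le n R y s x t; try lia.
by exists h; split; rewrite // eq_sym.
Qed.

Lemma planar_separation (n R x t y s : int) :
  0 <= n -> n + 2 < `|x| + `|t| ->
  ~ (x = y /\ t = s) -> ~ (x = R /\ t = 0) ->
  exists h, [/\ planar_harmonic h,
    forall u w, `|u| + `|w| <= n -> h u w = 0, h R 0 = 0 & h x t != h y s].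
Proof.
move=> n0 big neq pv; have [R0|R0] := eqVneq R 0; last first.
  exact: planar_separation_nz.
(* For [R = 0] the condition at the pole follows from vanishing on the ball; |x| + 1 is a dummy
   nonzero pole that misses (x, t). *)
have [|||||h [hh hB _ hx]] := @planar_separation_nz n (`|x| + 1) x t y s; try lia.
by exists h; split; rewrite // R0 hB.
Qed.

Lemma planar_nonvanishing (n R x t : int) :
  0 <= n -> R = 0 \/ n + 1 < `|R| -> n < `|x| + `|t| -> ~ (x = R /\ t = 0) ->
  exists h, [/\ planar_harmonic h,
    forall u w, `|u| + `|w| <= n -> h u w = 0, h R 0 = 0 & h x t != 0].
Proof.
move=> n0 hR big pv.
(* For [R = 0] a dummy pole beyond the level of (x, t) is used; the comparison point is the origin,
   where [h] vanishes. *)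
pose R' := if R == 0 then `|x| + `|t| + 1 else R.
have R'E : R' = R /\ n + 1 < `|R| \/ R = 0 /\ R' = `|x| + `|t| + 1.
  by rewrite /R'; case: eqP; lia.
have [||||||||h [hh hB hR' hx]] := @planar_separation_le n R' x t 0 0;
  clear hR; try lia.
exists h; rewrite (hB 0 0) // in hx; split=> //.
by move: hR'; rewrite /R'; case: eqP => // -> _; apply: hB.
Qed.

(** * Harmonic functions on the lattice *)

(** Denominators are cleared so that everything stays in [int]; [lattice_harmonic_mean] restores the
    mean. *)
Definition lattice_harmonic (d : nat) (f : 'rV[int]_d -> int) : Prop :=
  forall x, \sum_(j < d) (f (x + unit_vec j) + f (x - unit_vec j))
            = f x *+ (2 * d).

Lemma lattice_harmonic_lift d (i j : 'I_d) h :
  i != j -> planar_harmonic h ->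
  lattice_harmonic (fun x : 'rV_d => h (x ord0 i) (x ord0 j)).
Proof.
move=> ij hh x /=.
pose F k := h ((x + unit_vec k) ord0 i) ((x + unit_vec k) ord0 j) +
            h ((x - unit_vec k) ord0 i) ((x - unit_vec k) ord0 j).
pose c := h (x ord0 i) (x ord0 j).
(* Directions other than [i] and [j] contribute exactly [c *+ 2]; after subtracting this everywhere
   only planar harmonicity remains. *)
rewrite -/c; transitivity (\sum_k (F k - c *+ 2) + \sum_(k < d) c *+ 2).
  by rewrite -big_split /=; apply: eq_bigr => k _; rewrite subrK.
rewrite sumr_const card_ord -mulrnA.
suff -> : \sum_k (F k - c *+ 2) = 0 by rewrite add0r.
rewrite (bigD1 i) //= (bigD1 j) 1?eq_sym //= big1 => [|k /andP[ki kj]].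
  rewrite /F !mxE /= !eqxx (eq_sym j i) (negbTE ij) oppr0 !addr0.
  have := hh (x ord0 i) (x ord0 j); rewrite -/c => e; rewrite mulr2n.
  by rewrite -[(nat_of_bool true)%:R]/(1 : int) -[RHS](subrr (4 * c)) -{1}e; ring.
by rewrite /F !mxE /= (eq_sym i) (eq_sym j) (negbTE ki) (negbTE kj) oppr0 !addr0
  -mulr2n subrr.
Qed.

Lemma lattice_harmonic_coord d (i : 'I_d) :
  lattice_harmonic (fun x : 'rV_d => x ord0 i).
Proof.
move=> x /=; rewrite -[RHS]mulr_natl.
rewrite (eq_bigr (fun=> x ord0 i *+ 2)) => [|j _]; last first.
  by rewrite !mxE mulr2n; ring.
by rewrite sumr_const card_ord -mulrnA mulr_natl.
Qed.

Lemma lattice_harmonicD_mul d (f g : 'rV[int]_d -> int) c :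
  lattice_harmonic f -> lattice_harmonic g ->
  lattice_harmonic (fun x => f x + c * g x).
Proof.
move=> hf hg x /=; rewrite mulrnDl -hf -mulrnAr -hg mulr_sumr -big_split /=.
by apply: eq_bigr => j _; ring.
Qed.

(** * Balls in the lattice and functions vanishing at a far axis point *)

(** Chosen so that a planar function vanishing on the l1-ball of radius [n] lifts, through any two
    coordinates, to a function vanishing here. *)
Definition pair_ball (d n : nat) (x : 'rV[int]_d) : bool :=
  [forall i, forall j, (i != j) ==> (`|x ord0 i| + `|x ord0 j| <= n%:Z)].

Lemma pair_ballP d n (x : 'rV[int]_d) :
  reflect (forall i j, i != j -> `|x ord0 i| + `|x ord0 j| <= n%:Z)
          (pair_ball n x).
Proof.
apply: (iffP forallP) => [h i j ij|h i].
  by have /forallP/(_ j) := h i; rewrite ij.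
by apply/forallP => j; apply/implyP => ij; apply: h.
Qed.

Lemma pair_ballPn d n (x : 'rV[int]_d) :
  ~~ pair_ball n x ->
  exists i j, i != j /\ n%:Z < `|x ord0 i| + `|x ord0 j|.
Proof.
rewrite negb_forall => /existsP[i]; rewrite negb_forall => /existsP[j].
by rewrite negb_imply => /andP[ij]; rewrite -ltNge; exists i, j.
Qed.

Lemma rV_neq d (x y : 'rV[int]_d) : x != y -> exists k, x ord0 k != y ord0 k.
Proof.
move=> xy; apply/existsP; apply: contraNT xy; rewrite negb_exists => /forallP h.
by apply/eqP/rowP => k; apply/eqP; have := h k; rewrite negbK.
Qed.

Section Pole.
Variable d : nat.
Implicit Types (n R : nat) (x p q : 'rV[int]_d.+2).

Definition pole R : 'rV[int]_d.+2 := \row_k (if k == ord0 then R%:Z else 0).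

Definition vanishing_on n (h : 'rV[int]_d.+2 -> int) : Prop :=
  lattice_harmonic h /\ forall x, pair_ball n x -> h x = 0.

Lemma pole0 R : pole R ord0 ord0 = R. Proof. by rewrite mxE. Qed.

Lemma poleN0 R k : k != ord0 -> pole R ord0 k = 0.
Proof. by rewrite mxE => /negbTE ->. Qed.

Lemma lift_vanishing_on n (i j : 'I_d.+2) h :
  i != j -> planar_harmonic h ->
  (forall u w, `|u| + `|w| <= n%:Z -> h u w = 0) ->
  vanishing_on n (fun x => h (x ord0 i) (x ord0 j)).
Proof.
move=> ij hh hB; split; first exact: lattice_harmonic_lift.
by move=> x /pair_ballP xB; apply: hB; apply: xB.
Qed.

Lemma pair_separation n R p q (i j : 'I_d.+2) :
  i != j -> j != ord0 ->
  (p ord0 i != pole R ord0 i) || (p ord0 j != 0) ->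
  (p ord0 i != q ord0 i) || (p ord0 j != q ord0 j) ->
  n%:Z + 2 < `|p ord0 i| + `|p ord0 j| ->
  exists h, [/\ vanishing_on n h, h (pole R) = 0 & h p != h q].
Proof.
move=> ij j0 pv pq big.
have [||||h [hh hB hR hx]] := @planar_separation n (pole R ord0 i)
  (p ord0 i) (p ord0 j) (q ord0 i) (q ord0 j); try lia.
exists (fun x => h (x ord0 i) (x ord0 j)).
by split; [exact: lift_vanishing_on|rewrite (poleN0 _ j0)|].
Qed.

Lemma pole_nonvanishing n R q :
  q != pole R -> ~~ pair_ball n q -> (n.+1 < R)%N ->
  exists h, [/\ vanishing_on n h, h (pole R) = 0 & h q != 0].
Proof.
move=> qv qB nR.
have pairP i j : i != j -> j != ord0 -> n%:Z < `|q ord0 i| + `|q ord0 j| ->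
    (q ord0 i != pole R ord0 i) || (q ord0 j != 0) ->
    exists h, [/\ vanishing_on n h, h (pole R) = 0 & h q != 0].
  move=> ij j0 big pv.
  have [||||h [hh hB hR hx]] := @planar_nonvanishing n (pole R ord0 i)
    (q ord0 i) (q ord0 j); try lia.
    have [->|/poleN0 ->] := eqVneq i ord0; [rewrite pole0|]; lia.
  exists (fun x => h (x ord0 i) (x ord0 j)).
  by split; [exact: lift_vanishing_on|rewrite (poleN0 _ j0)|].
have {qB} [i [j [ij j0 big]]] : exists i j, [/\ i != j, j != ord0 &
    n%:Z < `|q ord0 i| + `|q ord0 j|].
  have [i [j [ij big]]] := pair_ballPn qB.
  have [j0|j0] := eqVneq j ord0; last by exists i, j.
  by exists j, i; rewrite eq_sym ij addrC big -j0 ij.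
have [pv|] := boolP ((q ord0 i != pole R ord0 i) || (q ord0 j != 0)).
  exact: pairP pv.
rewrite negb_or !negbK => /andP[/eqP qi /eqP qj].
(* [q] and the pole agree on [i] and [j], so [i] is the axis coordinate and [q] has [R] there. Some
   other coordinate [l] of [q] is nonzero, and the pair of 0 and [l] serves. *)
have i0 : i = ord0.
  apply/eqP; apply: contraLR big => i0; rewrite qi qj poleN0 //; lia.
have [l ql] := rV_neq qv.
have l0 : l != ord0.
  by apply: contraNneq ql => ->; rewrite -i0 qi.
rewrite i0 pole0 in qi; rewrite poleN0 // in ql.
apply: (pairP ord0 l) => //; [by rewrite eq_sym|lia|by rewrite ql orbT].
Qed.

(* [p] has a coordinate larger than [n + 2] in absolute value, so pairing it with
   a coordinate where [p] and [q] differ gives planar points to separate; the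
   case analysis avoids pairs in which [p] projects onto the pole. *)
Lemma pole_separation n R p q :
  p != q -> p != pole R -> ~~ pair_ball (2 * n + 4) p ->
  exists h, [/\ vanishing_on n h, h (pole R) = 0 & h p != h q].
Proof.
move=> pq pv /pair_ballPn[a [b [_ ab]]].
have {a b ab} [i big] : exists i, n%:Z + 2 < `|p ord0 i|.
  have [ha|ha] := ltP (n%:Z + 2) `|p ord0 a|; first by exists a.
  by exists b; lia.
have [k pk] := rV_neq pq.
have [i0|i0] := eqVneq i ord0; last first.
  have [ki|ki] := eqVneq k i.
    apply: (@pair_separation n R p q ord0 i) => //; first by rewrite eq_sym.
    + by apply/orP; right; lia.
    + by rewrite -ki pk orbT.
    + by lia.
  apply: (@pair_separation n R p q k i) => //; last by lia.
  - by apply/orP; right; lia.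
  - by rewrite pk.
rewrite i0 in big.
have [p0|p0] := eqVneq (p ord0 ord0) (q ord0 ord0); last first.
  have [l pl] := rV_neq pv.
  have [l0|l0] := eqVneq l ord0.
    apply: (@pair_separation n R p q ord0 ord_max) => //; last by lia.
    - by rewrite -l0 pl.
    - by rewrite p0.
  rewrite (poleN0 _ l0) in pl.
  apply: (@pair_separation n R p q ord0 l) => //; last by lia.
  - by rewrite eq_sym.
  - by rewrite pl orbT.
  - by rewrite p0.
have k0 : k != ord0 by apply: contraNneq pk => ->; rewrite p0.
have [pk0|pk0] := eqVneq (p ord0 k) 0; last first.
  apply: (@pair_separation n R p q ord0 k) => //; last by lia.
  - by rewrite eq_sym.
  - by rewrite pk0 orbT.
  - by rewrite pk orbT.
(* [p] may project onto the pole here, but [q] has the same large coordinate 0 and is nonzero at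
   [k], so the points are exchanged. *)
have [|||||h [hv hR hx]] := @pair_separation n R q p ord0 k => //.
- by rewrite eq_sym.
- by apply/orP; right; rewrite -pk0 eq_sym.
- by apply/orP; right; rewrite eq_sym.
- by lia.
by exists h; rewrite eq_sym.
Qed.

Lemma pole_bump n R : (n < R)%N ->
  exists h, vanishing_on n h /\ h (pole R) = 1.
Proof.
move=> nR; exists (fun x => cone (x ord0 ord0 - R%:Z) (x ord0 ord_max)).
split; last by rewrite pole0 poleN0 // subrr.
apply: (@lift_vanishing_on n ord0 ord_max (fun u w => cone (u - R%:Z) w)) => //.
  exact: (@planar_harmonic_reflect _ false false R%:Z cone_harmonic).
by move=> u w uw; apply: cone_eq0; lia.
Qed.

End Pole.

(** * Generic combinations and the extension step *)

Lemma lattice_harmonic_affine d (f g : 'rV[int]_d -> int) c :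
  lattice_harmonic f -> lattice_harmonic g ->
  lattice_harmonic (fun x => f x + c * (g x - f x)).
Proof.
move=> hf hg x /=; rewrite mulrnDl -mulrnAr mulrnBl -hf -hg -sumrB mulr_sumr.
by rewrite -big_split /=; apply: eq_bigr => j _; ring.
Qed.

(* Moving from [f] towards [g] by a step [c] larger than every difference
   [f p - f q] cannot create a coincidence. *)
Lemma simultaneous_separation (T : eqType) (C : (T -> int) -> Prop)
    (s : seq (T * T)) :
  (forall f g c, C f -> C g -> C (fun x => f x + c * (g x - f x))) ->
  (exists f, C f) ->
  (forall p, p \in s -> exists2 f, C f & f p.1 != f p.2) ->
  exists2 f, C f & forall p, p \in s -> f p.1 != f p.2.
Proof.
move=> Caff C0; elim: s => [|p0 s IH] sepP.
  by have [f Cf] := C0; exists f.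
have [|f Cf fs] := IH.
  by move=> p ps; apply: sepP; rewrite inE ps orbT.
have [g Cg gp0] := sepP p0 (mem_head _ _).
pose c : int := 1 + \sum_(p <- p0 :: s) `|f p.1 - f p.2|.
exists (fun x => f x + c * (g x - f x)); first exact: Caff.
move=> p ps.
have cD : `|f p.1 - f p.2| < c.
  rewrite /c (big_rem p ps) /= addrA ltr_wpDr ?sumr_ge0 //.
  by rewrite addrC ltrDl.
have c0 : 0 < c by apply: le_lt_trans cD.
rewrite -subr_eq0.
set D := f p.1 - f p.2 in cD.
pose E := g p.1 - g p.2 - D.
have -> : f p.1 + c * (g p.1 - f p.1) - (f p.2 + c * (g p.2 - f p.2))
          = D + c * E by rewrite /E /D; ring.
have [E0|E0] := eqVneq E 0; last first.
  apply/eqP => DE; have {}DE : D = - (c * E) by lia.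
  move: cD; rewrite DE normrN normrM (gtr0_norm c0).
  by apply/negP; rewrite -leNgt; apply: ler_peMr; lia.
(* For [E] = 0 the difference stays [D]: nonzero on old pairs by the choice of [f], and at [p0]
   equal to the nonzero difference of [g]. *)
rewrite E0 mulr0 addr0 /D subr_eq0.
move: ps; rewrite inE => /orP[/eqP pp0|/fs //].
by move: gp0 E0; rewrite -pp0 /E /D; lia.
Qed.

Lemma pair_ball_coord d n (x : 'rV[int]_d.+2) i :
  pair_ball n x -> `|x ord0 i| <= n%:Z.
Proof.
move=> /pair_ballP xB.
have [i0|i0] := eqVneq i ord0.
  have := xB i ord_max; rewrite i0 => /(_ isT); lia.
by have := xB i ord0 i0; lia.
Qed.

Lemma pair_ball_finite d n :
  exists s : seq 'rV[int]_d.+2, forall x, pair_ball n x -> x \in s.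
Proof.
pose row_of (f : {ffun 'I_d.+2 -> 'I_(2 * n).+1}) : 'rV[int]_d.+2 :=
  \row_i ((f i)%:Z - n%:Z).
exists [seq row_of f | f <- enum {: {ffun 'I_d.+2 -> 'I_(2 * n).+1}}] => x xB.
apply/mapP; exists [ffun i => inord (absz (x ord0 i + n%:Z))].
  by rewrite mem_enum.
apply/rowP => i; rewrite mxE ffunE; have xi := pair_ball_coord i xB.
have -> : x 0 i = x ord0 i by congr (x _ i); apply: val_inj.
by rewrite inordK; lia.
Qed.

Lemma pair_ballW d m n (x : 'rV[int]_d) :
  (m <= n)%N -> pair_ball m x -> pair_ball n x.
Proof.
by move=> mn /pair_ballP xB; apply/pair_ballP => i j ij; have := xB i j ij; lia.
Qed.

Lemma pole_pair_ball d R : pair_ball R (pole d R).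
Proof.
apply/pair_ballP => i j ij; rewrite !mxE.
by case: eqP => ?; case: eqP => ?; rewrite ?normr0 //; [|lia..]; subst; rewrite eqxx in ij.
Qed.

Lemma fresh_value (T : eqType) (s : seq T) (f : T -> int) :
  exists m, forall x, x \in s -> f x != m.
Proof.
exists (1 + \sum_(x <- s) `|f x|) => x xs.
have : `|f x| <= \sum_(x <- s) `|f x|.
  by rewrite (big_rem x xs) /= lerDl sumr_ge0.
by lia.
Qed.

Definition injective_on_ball d n (f : 'rV[int]_d -> int) : Prop :=
  forall p q, pair_ball n p -> pair_ball n q -> p != q -> f p != f q.

(** The pole at 2n + 5 lies just outside the ball where [f] is injective, so a bump there sets the
    value [m] without changing [f] on that ball. The constraints [C] are closed under affine steps,
    so it suffices to separate each pair singly. *)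
Lemma extension_fresh d n m (f : 'rV[int]_d.+2 -> int) :
  lattice_harmonic f -> injective_on_ball (2 * n + 4) f ->
  (forall x, pair_ball n x -> f x != m) ->
  exists g, [/\ lattice_harmonic g, injective_on_ball (2 * (2 * n + 5) + 4) g,
    (forall x, pair_ball n x -> g x = f x) & g (pole d (2 * n + 5)) = m].
Proof.
set R := (2 * n + 5)%N => fh fi fm; set v := pole d R.
pose C g := [/\ lattice_harmonic g, forall x, pair_ball n x -> g x = f x
  & g v = m].
have [b [[bh b0] bv]] : exists h, vanishing_on (2 * n + 4) h /\ h v = 1.
  by apply: pole_bump; rewrite /R; lia.
pose g0 x := f x + (m - f v) * b x.
have g0E x : pair_ball (2 * n + 4) x -> g0 x = f x.
  by move=> xB; rewrite /g0 b0 // mulr0 addr0.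
have Cg0 : C g0.
  split; first exact: lattice_harmonicD_mul.
    by move=> x xB; apply: g0E; apply: pair_ballW xB; lia.
  by rewrite /g0 bv; ring.
have Cadd h : vanishing_on n h -> h v = 0 -> C (fun x => g0 x + 1 * h x).
  move=> [hh h0] hv; have [g0h g0n g0v] := Cg0; split.
  - exact: lattice_harmonicD_mul.
  - by move=> x xB; rewrite h0 // g0n // mulr0 addr0.
  - by rewrite hv g0v mulr0 addr0.
have Csep h p q : vanishing_on n h -> h v = 0 -> h p != h q ->
    exists2 g, C g & g p != g q.
  move=> hn hv hpq; have [e|ne] := eqVneq (g0 p) (g0 q); last by exists g0.
  by exists (fun x => g0 x + 1 * h x); [exact: Cadd|rewrite e; lia].
have Csym p q : (exists2 g, C g & g p != g q) -> exists2 g, C g & g q != g p.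
  by case=> g Cg gpq; exists g; rewrite // eq_sym.
(* On the ball of radius [n] freshness of [m] separates; outside it, an increment vanishing at [v]
   but not at [q] does. *)
have sepv q : q != v -> exists2 g, C g & g q != g v.
  move=> qv; have [_ g0n g0v] := Cg0.
  have [qB|qB] := boolP (pair_ball n q).
    by exists g0; rewrite // g0v g0n // fm.
  have [|h [hn hv hq]] := pole_nonvanishing qv qB; first by rewrite /R; lia.
  by apply: (Csep h); rewrite ?hv.
have sep p q : p != q -> exists2 g, C g & g p != g q.
  move=> pq.
  have [pv|pv] := eqVneq p v.
    by apply: Csym; rewrite pv; apply: sepv; rewrite -pv eq_sym.
  have [qv|qv] := eqVneq q v; first by rewrite qv; apply: sepv.
  have [pB|pB] := boolP (pair_ball (2 * n + 4) p); last first.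
    by have [h [hn hv hpq]] := pole_separation pq pv pB; apply: (Csep h).
  have [qB|qB] := boolP (pair_ball (2 * n + 4) q); last first.
    rewrite eq_sym in pq; apply: Csym.
    by have [h [hn hv hpq]] := pole_separation pq qv qB; apply: (Csep h).
  by exists g0; rewrite // !g0E // fi.
have [s sP] := pair_ball_finite d (2 * R + 4).
have [|||g [gh gn gv] gs] := @simultaneous_separation _ C
  [seq p <- [seq (x, y) | x <- s, y <- s] | p.1 != p.2].
- move=> g h c [gh gn gv] [hh hn hv]; split.
  + exact: lattice_harmonic_affine.
  + by move=> x xB; rewrite gn // hn // subrr mulr0 addr0.
  + by rewrite gv hv subrr mulr0 addr0.
- by exists g0.
- by move=> [p q]; rewrite mem_filter => /andP[pq _]; apply: sep.
exists g; split=> // p q pB qB pq.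
apply: (gs (p, q)); rewrite mem_filter pq /=.
by apply/allpairsP; exists (p, q); split=> //; apply: sP.
Qed.

Lemma extension_hitting d n m (f : 'rV[int]_d.+2 -> int) :
  lattice_harmonic f -> injective_on_ball (2 * n + 4) f ->
  exists g, [/\ lattice_harmonic g, injective_on_ball (2 * (2 * n + 5) + 4) g,
    (forall x, pair_ball n x -> g x = f x) &
    exists2 x, pair_ball (2 * n + 5) x & g x = m].
Proof.
move=> fh fi; have [s sP] := pair_ball_finite d n.
have [/hasP[x _ /andP[xB /eqP fx]]|fm] :=
    boolP (has (fun x => pair_ball n x && (f x == m)) s).
  (* When [m] is already attained, a fresh value is placed at the pole merely to enlarge the ball of
     injectivity. *)
  have [m' m's] := fresh_value s f.
  have [|g [gh gi gf _]] := extension_fresh fh fi (m := m').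
    by move=> y /sP; apply: m's.
  exists g; split=> //; exists x; last by rewrite gf.
  by apply: pair_ballW xB; lia.
have [|g [gh gi gf gv]] := extension_fresh fh fi (m := m).
  move=> x xB; apply: contra fm => fx; apply/hasP; exists x; first exact: sP.
  by rewrite xB.
by exists g; split=> //; exists (pole d (2 * n + 5)); first exact: pole_pair_ball.
Qed.

Lemma injective_on_ball_exists d n :
  exists2 f : 'rV[int]_d.+2 -> int, lattice_harmonic f & injective_on_ball n f.
Proof.
have [s sP] := pair_ball_finite d n.
have [|||f fh fs] := @simultaneous_separation _ (@lattice_harmonic d.+2)
  [seq p <- [seq (x, y) | x <- s, y <- s] | p.1 != p.2].
- exact: lattice_harmonic_affine.
- by exists (fun x : 'rV_d.+2 => x ord0 ord0); apply: lattice_harmonic_coord.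
- move=> [p q]; rewrite mem_filter => /andP[/rV_neq[k pq] _].
  by exists (fun x : 'rV_d.+2 => x ord0 k) => //; apply: lattice_harmonic_coord.
exists f => // p q pB qB pq.
apply: (fs (p, q)); rewrite mem_filter pq /=.
by apply/allpairsP; exists (p, q); split=> //; apply: sP.
Qed.

(** * The limit labeling *)

Fixpoint stage_radius (k : nat) : nat :=
  if k is k'.+1 then 2 * stage_radius k' + 5 else 0.

Lemma leq_stage_radius k : (k <= stage_radius k)%N.
Proof. by elim: k => //= k IH; lia. Qed.

Lemma stage_radius_mono k l :
  (k <= l)%N -> (stage_radius k <= stage_radius l)%N.
Proof.
elim: l => [|l IH]; first by rewrite leqn0 => /eqP ->.
by rewrite leq_eqVlt => /orP[/eqP -> //|/IH] /=; lia.
Qed.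

Lemma coherent_stages d (m : nat -> int) :
  exists f : nat -> 'rV[int]_d.+2 -> int, forall k,
    [/\ lattice_harmonic (f k), injective_on_ball (stage_radius k) (f k),
      (forall x, pair_ball (stage_radius k) x -> f k.+1 x = f k x) &
      exists2 x, pair_ball (stage_radius k.+1) x & f k.+1 x = m k].
Proof.
(* Injectivity is carried on radius 2r + 4, as the next extension requires, while values are frozen
   only on radius r. *)
pose stage k := {f : 'rV[int]_d.+2 -> int |
  lattice_harmonic f /\ injective_on_ball (2 * stage_radius k + 4) f}.
have next k (s : stage k) : {s' : stage k.+1 |
    (forall x, pair_ball (stage_radius k) x -> sval s' x = sval s x) /\
    exists2 x, pair_ball (stage_radius k.+1) x & sval s' x = m k}.
  (* Choice turns the existence of an extension into a function, so that the stages can be defined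
     by recursion. *)
  apply: constructive_indefinite_description; case: s => f [fh fi] /=.
  have [g [gh gi gf gm]] := extension_hitting (m k) fh fi.
  by exists (exist _ g (conj gh gi)).
have stage0 : stage 0.
  apply: constructive_indefinite_description.
  have [f fh fi] := injective_on_ball_exists d (2 * stage_radius 0 + 4).
  by exists f.
pose s := nat_rect stage stage0 (fun k sk => sval (next k sk)).
exists (fun k => sval (s k)) => k.
have [fh fi] := svalP (s k); have [gf gm] := svalP (next k (s k)).
split=> // p q pB qB.
by apply: fi; [apply: pair_ballW pB|apply: pair_ballW qB]; lia.
Qed.

(** Serves as a stage index: from stage [l1norm x] on, the value at [x] is final. *)
Definition l1norm d (x : 'rV[int]_d) : nat := \sum_i absz (x ord0 i).

Lemma l1norm_pair_ball d (x : 'rV[int]_d) : pair_ball (l1norm x) x.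
Proof.
apply/pair_ballP => i j ij.
by rewrite /l1norm (bigD1 i) //= (bigD1 j) 1?eq_sym //=; lia.
Qed.

Lemma pair_ball_neighbour d n (x : 'rV[int]_d) j :
  pair_ball n x ->
  pair_ball (n + 2) (x + unit_vec j) /\ pair_ball (n + 2) (x - unit_vec j).
Proof.
move=> /pair_ballP xB; split; apply/pair_ballP => i k ik; rewrite !mxE /=;
  by have := xB i k ik; case: (i == j); case: (k == j) => /=; lia.
Qed.

Lemma stage_limit d (f : nat -> 'rV[int]_d.+2 -> int) (m : nat -> int) :
  (forall k, [/\ lattice_harmonic (f k), injective_on_ball (stage_radius k) (f k),
      (forall x, pair_ball (stage_radius k) x -> f k.+1 x = f k x) &
      exists2 x, pair_ball (stage_radius k.+1) x & f k.+1 x = m k]) ->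
  exists g : 'rV[int]_d.+2 -> int,
    [/\ lattice_harmonic g, injective g & forall k, exists x, g x = m k].
Proof.
move=> fP.
have stable k l x : (k <= l)%N -> pair_ball (stage_radius k) x -> f l x = f k x.
  move=> kl xB; elim: l kl => [|l IH]; first by rewrite leqn0 => /eqP ->.
  rewrite leq_eqVlt => /orP[/eqP -> //|kl]; rewrite -IH //.
  have [_ _ -> //] := fP l.
  by apply: pair_ballW xB; apply: stage_radius_mono.
have normB x : pair_ball (stage_radius (l1norm x)) x.
  by apply: pair_ballW (l1norm_pair_ball x); apply: leq_stage_radius.
pose g x := f (l1norm x) x.
have gE k x : pair_ball (stage_radius k) x -> g x = f k x.
  move=> xB; rewrite /g; have [lk|/ltnW kl] := leqP (l1norm x) k.
    by rewrite (stable _ _ _ lk).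
  by rewrite (stable _ _ _ kl).
have ballS k x : pair_ball k x -> pair_ball (stage_radius k) x.
  by apply: pair_ballW; apply: leq_stage_radius.
exists g; split.
(* At this stage the values at [x] and at all its neighbours are final. *)
- move=> x; set k := (l1norm x + 2)%N.
  have [fh _ _ _] := fP k.
  rewrite (gE k); last by apply: ballS; apply: pair_ballW (l1norm_pair_ball x); lia.
  rewrite -fh; apply: eq_bigr => j _.
  have [xp xm] := pair_ball_neighbour j (l1norm_pair_ball x).
  by rewrite !(gE k) //; apply: ballS.
- move=> x y; set k := maxn (l1norm x) (l1norm y).
  have xB : pair_ball (stage_radius k) x.
    by apply: ballS; apply: pair_ballW (l1norm_pair_ball x); apply: leq_maxl.
  have yB : pair_ball (stage_radius k) y.
    by apply: ballS; apply: pair_ballW (l1norm_pair_ball y); apply: leq_maxr.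
  rewrite !(gE k) // => /eqP e; apply/eqP; apply: contraLR e.
  by have [_ fi _ _] := fP k; apply: fi.
- move=> k; have [_ _ _ [x xB xm]] := fP k.
  by exists x; rewrite (gE k.+1).
Qed.

Lemma lattice_harmonic_bijection d : (0 < d)%N ->
  exists2 f : 'rV[int]_d -> int, lattice_harmonic f & bijective f.
Proof.
case: d => [//|[|d]] _.
  exists (fun x => x ord0 ord0); first exact: lattice_harmonic_coord.
  exists (fun m => \row_i m) => [x|m]; last by rewrite mxE.
  by apply/rowP => i; rewrite mxE !ord1.
(* Enumerates the integers: [y] is the target of stage [pickle y]. The default 0 at non-codes only
   repeats a target. *)
pose m k : int := odflt 0 (unpickle k).
have [f fP] := coherent_stages d m.
have [g [gh gi gs]] := stage_limit fP.
have surj y : exists x, g x == y.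
  have [x gx] := gs (pickle y); exists x.
  by rewrite gx /m pickleK.
exists g => //; exists (fun y => xchoose (surj y)) => [x|y].
  by apply: gi; apply/eqP; apply: (xchooseP (surj (g x))).
by apply/eqP; apply: (xchooseP (surj y)).
Qed.

(** * Neighbour lists and rational means *)

Definition lattice_neighbours d (x : 'rV[int]_d) : seq 'rV[int]_d :=
  [seq x + unit_vec j | j <- enum 'I_d] ++ [seq x - unit_vec j | j <- enum 'I_d].

Lemma unit_vec_inj d : injective (@unit_vec d).
Proof.
by move=> i j /rowP/(_ i); rewrite !mxE /= eqxx; case: eqP.
Qed.

Lemma neighbours_lattice d (x : 'rV[int]_d) :
  neighbours (@lattice_adj d) x (lattice_neighbours x).
Proof.
split.
  rewrite cat_uniq (map_inj_uniq (f := fun j => x + unit_vec j)); last first.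
    by move=> i j /= /addrI; apply: unit_vec_inj.
  rewrite (map_inj_uniq (f := fun j => x - unit_vec j)); last first.
    by move=> i j /= /addrI/oppr_inj; apply: unit_vec_inj.
  rewrite enum_uniq andbT /=.
  apply/hasPn => _ /mapP[j _ ->]; apply/mapP => -[i _] /= /addrI e.
  have /rowP/(_ i) := e.
  by rewrite !mxE /= eqxx; case: eqP.
move=> y; rewrite [RHS]/(lattice_adj x y) mem_cat.
apply/orP/existsP => [[] /mapP[j _ ->]|[i /andP[/eqP xy /forallP yx]]].
- exists j; apply/andP; split; first by rewrite !mxE /= eqxx; lia.
  by apply/forallP => k; apply/implyP => /negbTE kj; rewrite !mxE /= kj addr0.
- exists j; apply/andP; split; first by rewrite !mxE /= eqxx; lia.
  apply/forallP => k; apply/implyP => /negbTE kj.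
  by rewrite !mxE /= kj oppr0 addr0.
have yE k : k != i -> y ord0 k = x ord0 k.
  by move=> ki; have := yx k; rewrite ki => /eqP ->.
have dist1 (a b : int) : `|a - b| = 1 -> b = a + 1 \/ b = a - 1 by lia.
have [e|e] := dist1 _ _ xy.
  left; apply/mapP; exists i; rewrite ?mem_enum //; apply/rowP => k.
  rewrite !mxE /=; have [->|ki] := eqVneq k i; first by [].
  by rewrite yE // addr0.
right; apply/mapP; exists i; rewrite ?mem_enum //; apply/rowP => k.
rewrite !mxE /=; have [->|ki] := eqVneq k i; first by [].
by rewrite yE // oppr0 addr0.
Qed.

Lemma lattice_harmonic_mean d (f : 'rV[int]_d -> int) x :
  (0 < d)%N -> lattice_harmonic f ->
  (f x)%:~R = (2 * d)%:R^-1 *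
    \sum_(j < d) ((f (x + unit_vec j))%:~R + (f (x - unit_vec j))%:~R) :> rat.
Proof.
move=> d0 fh.
under eq_bigr do rewrite -intrD.
rewrite -rmorph_sum /= fh rmorphMn /= -[X in _ * X]mulr_natl mulKf //.
by rewrite pnatr_eq0; lia.
Qed.

Theorem theorem5 (d : nat) (hd : (1 <= d)%N) :
  exists phi : 'rV[int]_d -> int,
    harmonic_labeling (@lattice_adj d) phi /\
    forall x : 'rV[int]_d,
      (phi x)%:~R = (2 * d)%:R^-1 *
        \sum_(j < d) ((phi (x + unit_vec j))%:~R
                      + (phi (x - unit_vec j))%:~R) :> rat.
Proof.
have [f fh fb] := lattice_harmonic_bijection hd.
exists f; split; last by move=> x; apply: lattice_harmonic_mean.
split=> // x; exists (lattice_neighbours x).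
have sz : size (lattice_neighbours x) = (2 * d)%N.
  by rewrite size_cat !size_map -enumT size_enum_ord addnn mul2n.
split; [exact: neighbours_lattice|by rewrite sz; lia|].
rewrite sz (lattice_harmonic_mean _ hd fh) big_cat !big_map /= -enumT !big_enum /=.
by rewrite big_split.
Qed.
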